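(* Let $(X,d)$ be a Hadamard space and let $F:X\to X$ be a nonexpansive mapping with associated semigroup $(T_t)_{t\geq0}$. Let $y\in\mathrm{Fix}F$, $x\in X$ and let $b\in\mathbb{N}$ with $d(x,y)\leq b$. Let $X_0:=\overline{B}_b(y)$ and assume that $\gamma$ is a modulus of total boundedness for $X_0$. Then for all $\varepsilon>0$ and all nondecreasing $f:\mathbb{N}\to\mathbb{N}$: \[ \exists n\leq\Delta(\varepsilon,f)\ \forall s,t\in[n,n+f(n)]\ \left(d(T_t(x),T_s(x))\leq\varepsilon\right), \] where $\Delta(\varepsilon,f):=\varphi(\widehat\varepsilon_P)$ for $P:=\gamma(\varepsilon/6)+1$, with $\widehat\varepsilon_1:=\chi_f(\varepsilon/6,0)$ and, for $j\geq2$, $\widehat\varepsilon_j:=\chi_f\left(\varepsilon/6,\varphi(\widehat\varepsilon_{j-1})\right)$, where \[ \varphi(\delta):=\left\lceil\frac{4b}{\delta}\cdot e^{4b/\delta}\right\rceil\quad\text{and}\quad\chi_f(\delta,n):=\frac{2\delta}{e^{2(f(n+1)+1)}-1}. \]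
   Context: $\mathbb{N}$ contains $0$. A Hadamard space is a complete geodesic metric space of nonpositive curvature in the sense of Alexandrov (complete CAT(0) space); it is uniquely geodesic, and $(1-\lambda)u\oplus\lambda v$ denotes the point $w$ on the geodesic from $u$ to $v$ with $d(u,w)=\lambda d(u,v)$ and $d(v,w)=(1-\lambda)d(u,v)$. For $x\in X$ and $t>0$, $R_t(x)$ is the unique fixed point of the strict contraction $G_{x,t}(u):=\frac{1}{1+t}x\oplus\frac{t}{1+t}F(u)$ ($R_0:=\mathrm{Id}$), and $T_t(x):=\lim_{n\to\infty}(R_{t/n})^{(n)}(x)$ for $t\geq0$, where $(\cdot)^{(n)}$ denotes $n$-fold iteration (this limit exists and $(T_t)$ is a nonexpansive semigroup). $\mathrm{Fix}F$ is the set of fixed points of $F$, and $\overline{B}_b(y)$ is the closed ball. A function $\gamma:(0,\infty)\to\mathbb{N}$ is a modulus of total boundedness for a nonempty set $A\subseteq X$ if for any $\varepsilon>0$ and any sequence $(x_k)_{k\in\mathbb{N}}$ in $A$ there are $0\leq i<j\leq\gamma(\varepsilon)$ with $d(x_i,x_j)\leq\varepsilon$. *)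

(* Defs.v *)
From HB Require Import structures.
From mathcomp Require Import all_boot all_order all_algebra.
From mathcomp Require Import all_classical all_reals all_analysis.

Set Implicit Arguments.
Unset Strict Implicit.
Unset Printing Implicit Defensive.

Import Order.TTheory GRing.Theory Num.Theory.

Local Open Scope classical_set_scope.
Local Open Scope ring_scope.

#[short(type="completeMetricType")]
HB.structure Definition CompleteMetric (K : numDomainType) :=
  {T of Complete T & Metric K T}.

Section hadamard.
Variable R : realType.

(* The Euclidean plane is R * R with the distance below; the norm that the
   library puts on a product is the sup norm. *)
Definition edist (u v : R * R) : R :=
  Num.sqrt ((u.1 - v.1) ^+ 2 + (u.2 - v.2) ^+ 2).

Definition esegment (u v : R * R) (l : R) : R * R :=
  ((1 - l) * u.1 + l * v.1, (1 - l) * u.2 + l * v.2).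

Variable X : metricType R.

(* Only the values of c on [0, mdist p q] are relevant. *)
Definition is_geodesic (p q : X) (c : R -> X) : Prop :=
  [/\ c 0 = p, c (mdist p q) = q &
      {in `[0, mdist p q] &, forall s t, mdist (c s) (c t) = `|s - t|}].

Definition geodesic_space : Prop :=
  forall p q : X, exists c, is_geodesic p q c.

(* Alexandrov's comparison of a geodesic triangle with a Euclidean triangle
   p', q', r' of the same side lengths. Since p, q, r are arbitrary, it is enough
   to compare points on the two sides issued from p; points on the same side are
   at the same distance as their comparison points. *)
Definition nonpositively_curved : Prop :=
  forall (p q r : X) (c1 c2 c3 : R -> X),
    is_geodesic p q c1 -> is_geodesic p r c2 -> is_geodesic q r c3 ->
  forall p' q' r' : R * R,
    edist p' q' = mdist p q -> edist p' r' = mdist p r ->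
    edist q' r' = mdist q r ->
  {in `[0, 1] &, forall l m : R,
    mdist (c1 (l * mdist p q)) (c2 (m * mdist p r))
      <= edist (esegment p' q' l) (esegment p' r' m)}.

End hadamard.

Definition hadamard (R : realType) (X : completeMetricType R) : Prop :=
  geodesic_space X /\ nonpositively_curved X.

Definition nonexpansive (R : realType) (X : metricType R) (F : X -> X) : Prop :=
  forall u v, mdist (F u) (F v) <= mdist u v.

(* [get] selects an element of a set and is arbitrary on the empty set; in the
   definitions of [gconv] and [resolvent] the set is a singleton when X is
   Hadamard, F is nonexpansive, l is in [0, 1] and 0 < t. *)
Section semigroup.
Variables (R : realType) (X : completeMetricType R).

(* (1 - l) u (+) l v *)
Definition gconv (l : R) (u v : X) : X :=
  get [set w | mdist u w = l * mdist u v /\ mdist v w = (1 - l) * mdist u v].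

Variable F : X -> X.

(* G_{x,t}; the weight 1 - t / (1 + t) of x is 1 / (1 + t). *)
Definition resolvent_map (x : X) (t : R) (u : X) : X :=
  gconv (t / (1 + t)) x (F u).

Definition resolvent (t : R) (x : X) : X :=
  if t == 0 then x else get [set u | resolvent_map x t u = u].

(* The term of index n = 0, where t / 0 = 0 by convention, does not affect the
   limit. *)
Definition semigroup (t : R) (x : X) : X :=
  lim (iter n (resolvent (t / n%:R)) x @[n --> \oo]).

End semigroup.

(* The library's [closed_ball] is the closure of the open ball, which is empty
   for the radius 0. *)
Definition cball (R : realType) (X : metricType R) (y : X) (r : R) : set X :=
  [set z | mdist y z <= r].

(* Only the values of gamma on positive reals are constrained. *)
Definition total_boundedness_modulus (R : realType) (X : metricType R)
    (A : set X) (gamma : R -> nat) : Prop :=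
  forall (e : R) (u : nat -> X), 0 < e -> (forall k, A (u k)) ->
  exists i j : nat, [/\ (i < j)%N, (j <= gamma e)%N & mdist (u i) (u j) <= e].

Section rate.
Variables (R : realType) (b : nat) (f : nat -> nat).

Definition phi (delta : R) : nat :=
  `|Num.ceil (4 * b%:R / delta * expR (4 * b%:R / delta))|%N.

Definition chi (delta : R) (n : nat) : R :=
  2 * delta / (expR (2 * (f (n + 1) + 1)%:R) - 1).

(* Indexed from 1; the value at 0 is a dummy. *)
Fixpoint eps_hat (e : R) (j : nat) : R :=
  match j with
  | 0 => 0
  | 1 => chi (e / 6) 0
  | j'.+1 => chi (e / 6) (phi (eps_hat e j'))
  end.

Definition Delta (gamma : R -> nat) (e : R) : nat :=
  phi (eps_hat e (gamma (e / 6) + 1)).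

End rate.

(* Main.v *)
Require Import Defs.
From HB Require Import structures.
From mathcomp Require Import all_boot all_order all_algebra.
From mathcomp Require Import all_classical all_reals all_analysis.
From mathcomp Require Import ring lra.

(** The proof combines a rate of asymptotic regularity for the semigroup with a
    pigeonhole argument in the totally bounded ball around the fixed point [y].

    Geometry enters only through the CN inequality of Bruhat and Tits,
      d(w,r)^2 <= (1-l) d(p,r)^2 + l d(q,r)^2 - l(1-l) d(p,q)^2
    for w = (1-l) p (+) l q ([CN_inequality]), read off from a Euclidean
    comparison triangle. It yields uniqueness of w and Busemann convexity of the
    metric, hence existence, uniqueness and nonexpansiveness of the resolvents
    R_t.

    Existence of T_t is the Crandall-Liggett theorem. Points between x and R_l x
    have resolvents of smaller parameter that agree with R_l x
    ([resolvent_identity]); together with the CN inequality this gives, by a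
    double induction, an explicit bound on the distance between implicit Euler
    schemes of different step sizes ([iter_resolvent_compare]). The same bound
    shows that T_t x is the limit of Euler schemes of any vanishing step size
    ([semigroup_mesh_cvg]), whence the semigroup law [semigroupD].

    For the rate, an Euler step u of size t started at x satisfies
    d(u,y)^2 + t d(u,Fu)^2 <= d(x,y)^2, again by CN. As d(u,Fu) decreases along
    the scheme, summation gives t d(T_t x, F T_t x)^2 <= d(x,y)^2
    ([semigroup_defect]). So T_t x moves by at most delta under F as soon as
    t >= (b/delta)^2, and phi(delta) is at least that large.

    Finally put k_j := phi(eps_hat_(j+1)) and z_j := T_(k_j) x. Total boundedness
    provides i < j with d(z_i, z_j) <= eps/6. By the choice of eps_hat, F moves
    z_j so little that T_s moves z_j by at most eps/6 for all
    s <= f(k_(j-1) + 1) + 1, in particular for s <= f(k_i). Hence T_(k_i + s) x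
    stays within eps/3 of z_j for these s, and n := k_i is as required. *)

Set Implicit Arguments.
Unset Strict Implicit.
Unset Printing Implicit Defensive.

Import Order.TTheory GRing.Theory Num.Theory.
Local Open Scope classical_set_scope.
Local Open Scope ring_scope.

(** * Hadamard spaces: CN inequality and Busemann convexity *)

Section geometry.
Variables (R : realType) (X : completeMetricType R).
Implicit Types (u v w p q r : X) (l : R).

(** The point w = (1-l) u (+) l v, by [between_unique]. *)
Definition between l u v w : Prop :=
  mdist u w = l * mdist u v /\ mdist v w = (1 - l) * mdist u v.

Lemma between_sym l u v w : between l u v w -> between (1 - l) v u w.
Proof.
by move=> [h1 h2]; split; rewrite (metric_sym v u) ?h1 ?h2 //; congr (_ * _); ring.
Qed.

(** The triangle is placed with p at the origin and q on the first axis; the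
    height of r is real by Heron's formula and the triangle inequalities. *)
Lemma comparison_triangle p q r : exists p' q' r' : R * R,
  [/\ Defs.edist p' q' = mdist p q, Defs.edist p' r' = mdist p r &
      Defs.edist q' r' = mdist q r].
Proof.
have tri (u v w : X) := metric_triangle u v w.
have := tri p q r; have := tri p r q; have := tri q p r.
rewrite (metric_sym r q) (metric_sym q p).
have := mdist_ge0 p q; have := mdist_ge0 p r; have := mdist_ge0 q r.
move: (mdist p q) (mdist p r) (mdist q r) => a b c c0 b0 a0 h1 h2 h3.
have sqrt_eq (x y : R) : 0 <= y -> x = y ^+ 2 -> Num.sqrt x = y.
  by move=> y0 ->; rewrite sqrtr_sqr ger0_norm.
have [a_eq0|aN0] := eqVneq a 0.
  have bc : b = c by lra.
  exists (0, 0), (0, 0), (b, 0); rewrite /Defs.edist /=.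
  by split; apply: sqrt_eq => //; rewrite ?a_eq0 -?bc; ring.
pose x := (a ^+ 2 + b ^+ 2 - c ^+ 2) / (2 * a).
have h_ge0 : 0 <= b ^+ 2 - x ^+ 2.
  have -> : b ^+ 2 - x ^+ 2 =
      (c - a + b) * (c + a - b) * ((a + b - c) * (a + b + c)) / (2 * a) ^+ 2.
    by rewrite /x; field.
  by rewrite divr_ge0 ?sqr_ge0// !mulr_ge0//; lra.
exists (0, 0), (a, 0), (x, Num.sqrt (b ^+ 2 - x ^+ 2)); rewrite /Defs.edist /=.
split; apply: sqrt_eq => //; first by ring.
- by rewrite !sub0r !sqrrN sqr_sqrtr//; ring.
- by rewrite sub0r sqrrN sqr_sqrtr// /x; field.
Qed.

(** In the plane, CN holds with equality (Stewart's theorem). *)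
Lemma edist_segmentE (p q r : R * R) l :
  Defs.edist (esegment p q l) (esegment p r 1) ^+ 2 =
  (1 - l) * Defs.edist p r ^+ 2 + l * Defs.edist q r ^+ 2
    - l * (1 - l) * Defs.edist p q ^+ 2.
Proof.
by rewrite /Defs.edist /esegment /= !sqr_sqrtr ?addr_ge0 ?sqr_ge0//; ring.
Qed.

Lemma geodesic_between l p q c : 0 <= l <= 1 -> is_geodesic p q c ->
  between l p q (c (l * mdist p q)).
Proof.
move=> /andP[l0 l1] [c0 cD cdist]; have D0 := mdist_ge0 p q.
have lD : l * mdist p q \in `[0, mdist p q].
  by rewrite in_itv /= mulr_ge0//= ler_piMl.
split.
- rewrite -{1}c0 cdist ?in_itv /= ?lexx//.
  by rewrite sub0r normrN ger0_norm ?mulr_ge0.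
- rewrite -{1}cD cdist ?in_itv /= ?lexx ?D0//.
  have -> : mdist p q - l * mdist p q = (1 - l) * mdist p q by ring.
  by rewrite ger0_norm// mulr_ge0// subr_ge0.
Qed.

Hypothesis hX : hadamard X.

Lemma between_exists l u v : 0 <= l <= 1 -> exists w, between l u v w.
Proof.
move=> l01; have [c hc] := hX.1 u v.
by exists (c (l * mdist u v)); exact: geodesic_between.
Qed.

Lemma geodesic_CN l p q r c : 0 <= l <= 1 -> is_geodesic p q c ->
  mdist (c (l * mdist p q)) r ^+ 2 <=
  (1 - l) * mdist p r ^+ 2 + l * mdist q r ^+ 2 - l * (1 - l) * mdist p q ^+ 2.
Proof.
move=> l01 hc; have [c2 hc2] := hX.1 p r; have [c3 hc3] := hX.1 q r.
have [p' [q' [r' [pq pr qr]]]] := comparison_triangle p q r.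
have l1 : (1 : R) \in `[0, 1] by rewrite in_itv /= ler01 lexx.
have := hX.2 p q r c c2 c3 hc hc2 hc3 p' q' r' pq pr qr l 1 l01 l1.
have [_ c2r _] := hc2; rewrite mul1r c2r -pq -pr -qr -edist_segmentE => h.
by rewrite ler_pXn2r// nnegrE ?mdist_ge0 ?sqrtr_ge0.
Qed.

(** Two points with the same distances to u and v coincide because the
    right-hand side of CN, for a geodesic point against either of them, is 0. *)
Lemma between_unique l u v w w' : 0 <= l <= 1 ->
  between l u v w -> between l u v w' -> w = w'.
Proof.
move=> l01; have [c hc] := hX.1 u v.
suff H z : between l u v z -> c (l * mdist u v) = z.
  by move=> /H <- /H <-.
move=> [uz vz]; apply: mdist_positivity; apply/eqP; rewrite -sqrf_eq0.
rewrite eq_le sqr_ge0 andbT; apply: le_trans (geodesic_CN _ l01 hc) _.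
by rewrite uz vz; lra.
Qed.

Lemma CN_inequality l p q r w : 0 <= l <= 1 -> between l p q w ->
  mdist w r ^+ 2 <=
  (1 - l) * mdist p r ^+ 2 + l * mdist q r ^+ 2 - l * (1 - l) * mdist p q ^+ 2.
Proof.
move=> l01 pqw; have [c hc] := hX.1 p q.
rewrite (between_unique l01 pqw (geodesic_between l01 hc)).
exact: geodesic_CN.
Qed.

(** Applying CN to w against w' and then to w' against q, the terms that do not
    involve d(q,r) cancel. *)
Lemma between_thales l p q r w w' : 0 <= l <= 1 ->
  between l p q w -> between l p r w' -> mdist w w' <= l * mdist q r.
Proof.
move=> l01 pqw prw'; have /andP[l0 l1] := l01.
have h1 := CN_inequality w' l01 pqw.
have h2 := CN_inequality q l01 prw'.
rewrite -(ler_pXn2r (n := 2))// ?nnegrE ?mulr_ge0 ?mdist_ge0//.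
rewrite (metric_sym w' q) (metric_sym r q) in h2.
have [pw' _] := prw'; rewrite pw' in h1.
have := ler_wpM2l l0 h2; lra.
Qed.

(** Two applications of [between_thales], along a diagonal of the quadrilateral
    p, q, q', p'. *)
Lemma between_busemann l p q p' q' w w' : 0 <= l <= 1 ->
  between l p q w -> between l p' q' w' ->
  mdist w w' <= (1 - l) * mdist p p' + l * mdist q q'.
Proof.
move=> l01 pqw pqw'; have [z pqz] := between_exists p q' l01.
have l01' : 0 <= 1 - l <= 1 by lra.
have := between_thales l01' (between_sym pqz) (between_sym pqw').
have := between_thales l01 pqw pqz.
have := metric_triangle w z w'; lra.
Qed.

Lemma gconv_between l u v : 0 <= l <= 1 -> between l u v (gconv l u v).
Proof. by move=> l01; apply: getPex; exact: between_exists. Qed.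

End geometry.

(** * Sequences in complete metric spaces *)

Section metric_limits.
Variables (R : realType) (X : completeMetricType R).
Implicit Types (u v : nat -> X).

Lemma cvg_mdistP u (a : X) : u @ \oo --> a <->
  forall e, 0 < e -> exists N, forall n, (N <= n)%N -> mdist a (u n) < e.
Proof.
rewrite cvg_ballP; split => h e e0; have := h e e0.
- by rewrite ballEmdist => -[N _ hN]; exists N => n Nn; apply: hN.
- by rewrite ballEmdist => -[N hN]; exists N.
Qed.

Lemma cauchy_mdist_cvg u :
  (forall e, 0 < e -> exists N, forall m n, (N <= m)%N -> (N <= n)%N ->
    mdist (u m) (u n) < e) -> cvgn u.
Proof.
move=> h; apply/cauchy_cvgP/cauchy_exP => e /h[N hN].
exists (u N); exists N => // n Nn; rewrite /= ballEmdist /=; exact: hN.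
Qed.

Lemma cvg_mdist_le u v (a a' : X) c N : u @ \oo --> a -> v @ \oo --> a' ->
  (forall n, (N <= n)%N -> mdist (u n) (v n) <= c) -> mdist a a' <= c.
Proof.
move=> /cvg_mdistP hu /cvg_mdistP hv h; apply/ler_addgt0Pr => e e0.
have e2 : 0 < e / 2 by rewrite divr_gt0.
have [M hM] := hu _ e2; have [K hK] := hv _ e2.
pose n := maxn N (maxn M K).
have := h n (leq_maxl _ _); have := hM n; have := hK n.
rewrite /n !leq_max !leqnn !orbT => /(_ isT) ? /(_ isT) ? ?.
have := metric_triangle a (u n) a'; have := metric_triangle (u n) (v n) a'.
rewrite (metric_sym (v n)) /n; lra.
Qed.

(** Banach's fixed point theorem. *)
Lemma contraction_fixpoint (G : X -> X) (l : R) : 0 <= l < 1 ->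
  (forall p q, mdist (G p) (G q) <= l * mdist p q) -> exists p, G p = p.
Proof.
move=> /andP[l0 l1] hG; pose a n := iter n G point.
have step n : mdist (a n) (a n.+1) <= l ^+ n * mdist (a 0) (a 1).
  elim: n => [|n IH]; first by rewrite expr0 mul1r.
  by rewrite exprS -mulrA; apply: le_trans (hG _ _) _; exact: ler_wpM2l.
(* The geometric series of the steps is bounded in a form without division. *)
pose D := mdist (a 0) (a 1); have D0 : 0 <= D := mdist_ge0 _ _.
have tail n k : (1 - l) * mdist (a n) (a (n + k)%N) <= l ^+ n * (1 - l ^+ k) * D.
  elim: k => [|k IH]; first by rewrite addn0 mdistxx expr0 subrr !mulr0 mul0r.
  have h1 := metric_triangle (a n) (a (n + k)%N) (a (n + k.+1)%N).
  have := step (n + k)%N; rewrite -addnS exprD -/D => h2.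
  have l1' : 0 <= 1 - l by lra.
  have := ler_wpM2l l1' (le_trans h1 (lerD (lexx _) h2)); rewrite exprS; lra.
have cva : cvgn a.
  apply: cauchy_mdist_cvg => e e0.
  have : \forall n \near \oo, `|l ^+ n| < (1 - l) * e / (2 * (D + 1)).
    have c0 : 0 < (1 - l) * e / (2 * (D + 1)).
      by rewrite divr_gt0// ?mulr_gt0//; lra.
    have : `|l| < 1 by rewrite ger0_norm.
    by move=> /cvg_expr/cvgr0_norm_lt; apply.
  move=> [N _ /(_ N (leqnn _))]; rewrite ger0_norm ?exprn_ge0// => hN.
  exists N; suff H n : (N <= n)%N -> mdist (a N) (a n) < e / 2.
    move=> m n /H hm /H hn; have := metric_triangle (a m) (a N) (a n).
    rewrite (metric_sym (a m) (a N)); lra.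
  move=> /subnKC <-; have := tail N (n - N)%N.
  set k := (n - N)%N; set d := mdist _ _ => h.
  rewrite ltr_pdivlMr in hN; last by lra.
  have lN : 0 <= l ^+ N by exact: exprn_ge0.
  have lND : 0 <= l ^+ N * D by rewrite mulr_ge0.
  have lk : 0 <= l ^+ k * (l ^+ N * D) by rewrite mulr_ge0 ?exprn_ge0.
  rewrite -(ltr_pM2l (x := 1 - l)); lra.
have /cvg_ex[z az] := cva; exists z; apply: mdist_positivity; apply/eqP; rewrite eq_le.
rewrite mdist_ge0 andbT; apply/ler_addgt0Pr => e e0; rewrite add0r.
have [N hN] := (cvg_mdistP _ _).1 az (e / 2) ltac:(lra).
have := hN N.+1 (leqnSn _); have := hN N (leqnn _).
have := hG z (a N); have := metric_triangle (G z) (G (a N)) z.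
have -> : a N.+1 = G (a N) by [].
rewrite (metric_sym (G (a N)) z) => h1 h2 h3 h4.
have := ler_piMl (mdist_ge0 z (a N)) (ltW l1); lra.
Qed.

End metric_limits.

(** * Resolvents and implicit Euler schemes *)

Section resolvents.
Variables (R : realType) (X : completeMetricType R) (F : X -> X).
Hypotheses (hX : hadamard X) (hF : nonexpansive F).
Implicit Types (x u v w y : X) (l p t : R) (m n : nat).

Notation J := (resolvent F).

Lemma step_itv t : 0 <= t -> 0 <= t / (1 + t) <= 1.
Proof.
move=> t0; rewrite divr_ge0 ?addr_ge0//= ler_pdivrMr; lra.
Qed.

(** Busemann convexity leaves d(u,v) <= t/(1+t) d(u,v), and t/(1+t) < 1. *)
Lemma implicit_step_unique t x u v : 0 <= t ->
  between (t / (1 + t)) x (F u) u -> between (t / (1 + t)) x (F v) v -> u = v.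
Proof.
move=> t0 hu hv; have st := step_itv t0.
have t1 : 1 + t != 0 by lra.
have := between_busemann hX st hu hv.
rewrite mdistxx mulr0 add0r => h; have h' := hF u v.
apply: mdist_positivity; apply/eqP; rewrite eq_le mdist_ge0 andbT.
have /andP[st0 _] := st.
have := le_trans h (ler_wpM2l st0 h').
rewrite mulrAC ler_pdivlMr; last by lra.
lra.
Qed.

(** The case t = 0 holds for R_0 = id as well, which lets the lemmas below cover
    steps of size 0. *)
Lemma resolvent_between t x : 0 <= t -> between (t / (1 + t)) x (F (J t x)) (J t x).
Proof.
move=> t0; have st := step_itv t0; rewrite /resolvent; have [->|tN0] := eqVneq t 0.
  by split; rewrite mul0r ?mdistxx ?mul0r// subr0 mul1r metric_sym.
suff : [set u | resolvent_map F x t u = u] (get [set u | resolvent_map F x t u = u]).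
  move=> /= {2}<-; exact: gconv_between.
apply: getPex; apply: (@contraction_fixpoint _ _ _ (t / (1 + t))).
  have /andP[-> _] /= := st; rewrite ltr_pdivrMr; lra.
move=> u v; have hu := gconv_between hX x (F u) st.
have := between_busemann hX st hu (gconv_between hX x (F v) st).
have /andP[st0 _] := st.
rewrite mdistxx mulr0 add0r => h; apply: le_trans h _; exact: ler_wpM2l.
Qed.

Lemma resolventE t x u : 0 <= t -> between (t / (1 + t)) x (F u) u -> J t x = u.
Proof.
move=> t0; apply: implicit_step_unique => //; exact: resolvent_between.
Qed.

Lemma resolvent_dist t x : 0 <= t ->
  mdist x (J t x) = t * mdist (J t x) (F (J t x)) /\
  mdist x (F (J t x)) = (1 + t) * mdist (J t x) (F (J t x)).
Proof.
move=> t0; have [h1 h2] := resolvent_between x t0.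
rewrite (metric_sym (J t x)) h1 h2; have t1 : 1 + t != 0 by lra.
by split; field.
Qed.

Lemma resolvent_nonexpansive t x y : 0 <= t -> mdist (J t x) (J t y) <= mdist x y.
Proof.
move=> t0; have t1 : 0 < 1 + t by lra.
have st := step_itv t0; have /andP[st0 _] := st.
have h := between_busemann hX st (resolvent_between x t0) (resolvent_between y t0).
have h' := hF (J t x) (J t y).
have := le_trans h (lerD (lexx _) (ler_wpM2l st0 h')).
have -> : 1 - t / (1 + t) = 1 / (1 + t) by field; lra.
rewrite (mulrAC t) (mulrAC 1) -mulrDl ler_pdivlMr//; lra.
Qed.

Lemma resolvent_defect_le t x : 0 <= t ->
  mdist (J t x) (F (J t x)) <= mdist x (F x).
Proof.
move=> t0; have [h1 h2] := resolvent_dist x t0.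
have := metric_triangle x (F x) (F (J t x)); have := hF x (J t x); lra.
Qed.

(** CN for R_t x on the geodesic from x to F (R_t x), where the distance of
    F (R_t x) to y is at most that of R_t x. *)
Lemma resolvent_energy t x y : 0 <= t -> F y = y ->
  mdist (J t x) y ^+ 2 + t * mdist (J t x) (F (J t x)) ^+ 2 <= mdist x y ^+ 2.
Proof.
move=> t0 hy; have t1 : 0 < 1 + t by lra.
have := CN_inequality hX y (step_itv t0) (resolvent_between x t0).
have [_ ->] := resolvent_dist x t0.
have h : mdist (F (J t x)) y ^+ 2 <= mdist (J t x) y ^+ 2.
  by rewrite ler_pXn2r ?nnegrE ?mdist_ge0// -{1}hy; exact: hF.
move: h; set A := mdist (F _) y; set B := mdist (J t x) y.
set C := mdist x y; set E := mdist _ (F _) => h1.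
have -> : 1 - t / (1 + t) = 1 / (1 + t) by field; lra.
have -> : 1 / (1 + t) * C ^+ 2 + t / (1 + t) * A ^+ 2 -
  t / (1 + t) * (1 / (1 + t)) * ((1 + t) * E) ^+ 2 =
  (C ^+ 2 + t * A ^+ 2 - t * (1 + t) * E ^+ 2) / (1 + t) by field; lra.
rewrite ler_pdivlMr// => h2.
have h3 := ler_wpM2l t0 h1.
have : 0 <= t * (t * E ^+ 2) by rewrite mulr_ge0 ?sqr_ge0// mulr_ge0 ?sqr_ge0.
lra.
Qed.

(** The points x, w, u = R_l x, F u lie in this order on a geodesic, and u
    divides the part from w to F u in the ratio that belongs to step size p l. *)
Lemma resolvent_identity l p x w : 0 <= l -> 0 <= p <= 1 ->
  between p (J l x) x w -> J (p * l) w = J l x.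
Proof.
move=> l0 /andP[p0 p1] [h1 h2]; have pl0 : 0 <= p * l by rewrite mulr_ge0.
apply: resolventE => //.
have [hx1 hx2] := resolvent_dist x l0; set u := J l x in h1 h2 hx1 hx2 *.
rewrite (metric_sym u x) hx1 in h1 h2.
set E := mdist u (F u) in h1 h2 hx1 hx2 *.
(* That w lies between x and F u follows since u does and w lies between x and u. *)
have wF : mdist w (F u) = (1 + p * l) * E.
  apply/eqP; rewrite eq_le; apply/andP; split.
    by have := metric_triangle w u (F u); rewrite (metric_sym w u) h1 -/E; lra.
  have := metric_triangle x w (F u); rewrite hx2 h2; lra.
have pl1 : 1 + p * l != 0 by lra.
split; rewrite wF; first by rewrite metric_sym h1; field.
by rewrite metric_sym -/E; field.
Qed.

Lemma iter_resolvent_nonexpansive t n x y : 0 <= t ->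
  mdist (iter n (J t) x) (iter n (J t) y) <= mdist x y.
Proof.
move=> t0; elim: n => [//|n IH].
by apply: le_trans IH; exact: resolvent_nonexpansive.
Qed.

Lemma iter_resolvent_defect_le t n x : 0 <= t ->
  mdist (iter n (J t) x) (F (iter n (J t) x)) <= mdist x (F x).
Proof.
move=> t0; elim: n => [//|n IH].
by apply: le_trans IH; exact: resolvent_defect_le.
Qed.

Lemma iter_resolvent_dist t n x : 0 <= t ->
  mdist x (iter n (J t) x) <= n%:R * t * mdist x (F x).
Proof.
move=> t0; elim: n => [|n IH]; first by rewrite mdistxx !mul0r.
have := metric_triangle x (iter n (J t) x) (iter n.+1 (J t) x).
have [h _] := resolvent_dist (iter n (J t) x) t0.
have h1 := ler_wpM2l t0 (iter_resolvent_defect_le n.+1 x t0).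
rewrite /= h -natr1; move: h1 => /=; lra.
Qed.

Lemma iter_resolvent_energy t n x y : 0 <= t -> F y = y ->
  mdist (iter n (J t) x) y ^+ 2 +
  n%:R * t * mdist (iter n (J t) x) (F (iter n (J t) x)) ^+ 2 <= mdist x y ^+ 2.
Proof.
move=> t0 hy; elim: n => [|n IH]; first by rewrite !mul0r addr0.
have := resolvent_energy (iter n (J t) x) t0 hy.
have := resolvent_defect_le (iter n (J t) x) t0.
rewrite -(ler_pXn2r (n := 2))// ?nnegrE ?mdist_ge0//.
rewrite -[J t (iter n (J t) x)]/(iter n.+1 (J t) x) -natr1.
have nt0 : 0 <= n%:R * t by rewrite mulr_ge0.
move=> /(ler_wpM2l nt0); lra.
Qed.

(** The Crandall-Liggett estimate. By the resolvent identity and CN, the squared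
    distance a(m,n) obeys a(m+1,n+1) <= (1-p) a(m+1,n) + p a(m,n). The bound
    solves this recursion with equality: up to the constant factor it is the second
    moment of m - B for B
    binomial with n trials and success probability p, and conditioning on one
    trial is the recursion. *)
Lemma iter_resolvent_compare_scaled l p x m n : 0 <= l -> 0 <= p <= 1 ->
  mdist (iter m (J l) x) (iter n (J (p * l)) x) ^+ 2 <=
  (l * mdist x (F x)) ^+ 2 * ((m%:R - n%:R * p) ^+ 2 + n%:R * p * (1 - p)).
Proof.
move=> l0 p01; have /andP[p0 p1] := p01.
have pl0 : 0 <= p * l by rewrite mulr_ge0.
have D0 := mdist_ge0 x (F x); set D := mdist x (F x) in D0 *.
elim: n m => [m|n IH [|m]].
- have -> : (l * D) ^+ 2 * ((m%:R - 0%:R * p) ^+ 2 + 0%:R * p * (1 - p)) =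
      (m%:R * l * D) ^+ 2 by ring.
  rewrite metric_sym ler_pXn2r ?nnegrE ?mdist_ge0 ?mulr_ge0//.
  exact: iter_resolvent_dist.
- have h : mdist x (iter n.+1 (J (p * l)) x) ^+ 2 <= (n.+1%:R * (p * l) * D) ^+ 2.
    rewrite ler_pXn2r ?nnegrE ?mdist_ge0 ?mulr_ge0//.
    exact: iter_resolvent_dist.
  apply: le_trans h _; rewrite -subr_ge0.
  set N := n.+1%:R.
  have -> : (l * D) ^+ 2 * ((0%:R - N * p) ^+ 2 + N * p * (1 - p)) -
      (N * (p * l) * D) ^+ 2 = (l * D) ^+ 2 * (N * p * (1 - p)) by ring.
  by rewrite !mulr_ge0// ?exprn_ge0 ?mulr_ge0// subr_ge0.
- set z := iter m (J l) x; set y := iter n (J (p * l)) x.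
  have [w hw] := between_exists hX (J l z) z p01.
  have -> : iter m.+1 (J l) x = J (p * l) w by rewrite (resolvent_identity l0 p01 hw).
  have h1 : mdist (J (p * l) w) (iter n.+1 (J (p * l)) x) ^+ 2 <= mdist w y ^+ 2.
    by rewrite ler_pXn2r ?nnegrE ?mdist_ge0//; exact: resolvent_nonexpansive.
  apply: le_trans h1 _; apply: le_trans (CN_inequality hX y p01 hw) _.
  have h1 := IH m.+1; have h2 := IH m; rewrite -[iter m.+1 _ _]/(J l z) -/z -/y in h1 h2.
  have q0 : 0 <= 1 - p by lra.
  have h3 := ler_wpM2l q0 h1; have h4 := ler_wpM2l p0 h2.
  have h5 : 0 <= p * (1 - p) * mdist (J l z) z ^+ 2.
    by rewrite mulr_ge0 ?sqr_ge0// mulr_ge0 ?sqr_ge0.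
  apply: le_trans (_ : _ <= (1 - p) * mdist (J l z) y ^+ 2 + p * mdist z y ^+ 2) _.
    by lra.
  apply: le_trans (lerD h3 h4) _; rewrite -!natr1 le_eqVlt; apply/orP; left.
  by apply/eqP; ring.
Qed.

(** A weaker form of [iter_resolvent_compare_scaled], symmetric in the two step
    sizes. *)
Lemma iter_resolvent_compare l l' x m n : 0 <= l -> 0 <= l' ->
  mdist (iter m (J l) x) (iter n (J l') x) ^+ 2 <=
  mdist x (F x) ^+ 2 *
    ((m%:R * l - n%:R * l') ^+ 2 + (m%:R * l + n%:R * l') * (l + l')).
Proof.
wlog ll' : l l' m n / l' <= l.
  move=> H l0 l0'; case: (leP l' l) => [|/ltW] h; first exact: H.
  by rewrite metric_sym; apply: le_trans (H _ _ _ _ h l0' l0) _; lra.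
move=> l0 l'0; have [p p01 pE] : exists2 p, 0 <= p <= 1 & l' = p * l.
  have [l_eq0|lN0] := eqVneq l 0; first by exists 0; lra.
  have lp : 0 < l by lra.
  exists (l' / l); last by rewrite divfK.
  by rewrite divr_ge0//= ler_pdivrMr// mul1r.
have := iter_resolvent_compare_scaled x m n l0 p01; rewrite pE.
move=> h; apply: le_trans h _; have /andP[p0 p1] := p01.
rewrite -subr_ge0; set D := mdist x _; set M := m%:R; set N := n%:R.
have -> : D ^+ 2 * ((M * l - N * (p * l)) ^+ 2 + (M * l + N * (p * l)) * (l + p * l))
  - (l * D) ^+ 2 * ((M - N * p) ^+ 2 + N * p * (1 - p)) =
  (l * D) ^+ 2 * (M + M * p + 2 * (N * p * p)) by ring.
by rewrite mulr_ge0 ?sqr_ge0// !addr_ge0// !mulr_ge0.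
Qed.

End resolvents.

(** * The semigroup *)

Section semigroups.
Variables (R : realType) (X : completeMetricType R) (F : X -> X).
Hypotheses (hX : hadamard X) (hF : nonexpansive F).
Implicit Types (x y : X) (e l s t : R) (m n : nat).

Notation J := (resolvent F).
Notation T := (semigroup F).

Lemma gt_truncn (z : R) n : 0 <= z -> (Num.truncn z < n)%N -> z < n%:R.
Proof. by move=> z0; rewrite truncn_lt_nat. Qed.

Lemma semigroup_cvg t x : 0 <= t ->
  iter n (J (t / n%:R)) x @[n --> \oo] --> T t x.
Proof.
move=> t0; apply: cauchy_mdist_cvg => e e0.
set D := mdist x (F x).
have D0 : 0 <= D := mdist_ge0 _ _.
have c0 : 0 <= (2 * t * D) ^+ 2 / e ^+ 2 by rewrite divr_ge0 ?sqr_ge0.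
(* The squared distance of the schemes with m and n steps is at most
   2 (t D)^2 (1/m + 1/n). *)
exists (Num.truncn ((2 * t * D) ^+ 2 / e ^+ 2)).+1 => m n hm hn.
have mesh k : (Num.truncn ((2 * t * D) ^+ 2 / e ^+ 2) < k)%N ->
    k%:R * (t / k%:R) = t /\ (2 * t * D) ^+ 2 * k%:R^-1 < e ^+ 2.
  move=> hk; have k0 : 0 < k%:R :> R by rewrite ltr0n; case: k hk.
  split; first by field; lra.
  rewrite ltr_pdivrMr// (mulrC (e ^+ 2)) -ltr_pdivrMr ?exprn_gt0//.
  exact: gt_truncn.
have [m1 m2] := mesh _ hm; have [n1 n2] := mesh _ hn.
rewrite -(ltr_pXn2r (n := 2))// ?nnegrE ?mdist_ge0 ?ltW//.
have := iter_resolvent_compare hX hF x m n (l := t / m%:R) (l' := t / n%:R).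
rewrite !divr_ge0// => /(_ isT isT); rewrite m1 n1 -/D => h.
apply: le_lt_trans h _; lra.
Qed.

(** Euler schemes with any small step l approximate T_t x, not only those with l a
    fraction of t. This allows comparing several times on one common mesh. *)
Lemma semigroup_mesh_cvg t x e : 0 <= t -> 0 < e ->
  exists2 d, 0 < d & forall l m, 0 < l -> l <= d -> `|m%:R * l - t| <= l ->
    mdist (iter m (J l) x) (T t x) <= e.
Proof.
move=> t0 e0; set D := mdist x (F x).
have D0 : 0 <= D := mdist_ge0 _ _.
pose K := D ^+ 2 * (3 + 4 * t); have K0 : 0 <= K.
  by rewrite mulr_ge0 ?sqr_ge0//; lra.
have K1 : 0 < K + 1 by lra.
(* For l <= 1 the squared distance to be bounded is at most K l; K may be 0,
   which the summand 1 compensates. *)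
exists (Num.min 1 (e ^+ 2 / (K + 1))).
  by rewrite lt_min ltr01 divr_gt0// exprn_gt0.
move=> l m l0; rewrite le_min ler_pdivlMr// => /andP[l1 lK] ml.
pose N := (Num.truncn (t / l)).+1.
apply: (cvg_mdist_le (N := N) (cvg_cst (iter m (J l) x)) (semigroup_cvg (x := x) t0)).
move=> n Nn; have n0 : 0 < n%:R :> R by rewrite ltr0n; case: (n) Nn.
have nl : t / n%:R <= l.
  rewrite ler_pdivrMr// mulrC -ler_pdivrMr//; apply: ltW.
  by apply: gt_truncn => //; rewrite divr_ge0// ltW.
rewrite -(ler_pXn2r (n := 2))// ?nnegrE ?mdist_ge0 ?(ltW e0)//.
have := iter_resolvent_compare hX hF x m n (l := l) (l' := t / n%:R).
have ntE : n%:R * (t / n%:R) = t by field; lra.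
rewrite (ltW l0) divr_ge0// => /(_ isT isT); rewrite ntE -/D => h.
apply: le_trans h _.
have h1 : (m%:R * l - t) ^+ 2 <= l ^+ 2.
  by rewrite -real_normK ?num_real// ler_pXn2r ?nnegrE// ltW.
have h2 : (m%:R * l + t) * (l + t / n%:R) <= (l + 2 * t) * (2 * l).
  apply: ler_pM; first by rewrite addr_ge0 ?mulr_ge0// ltW.
  - by rewrite addr_ge0 ?divr_ge0// ltW.
  - by move: ml; rewrite ler_norml => /andP[_ ?]; lra.
  - lra.
have h3 : l * l <= l * 1 by rewrite ler_pM2l.
have : D ^+ 2 * ((m%:R * l - t) ^+ 2 + (m%:R * l + t) * (l + t / n%:R)) <=
    D ^+ 2 * ((3 + 4 * t) * l).
  by apply: ler_wpM2l; [exact: sqr_ge0|lra].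
rewrite mulrA -/K; lra.
Qed.

Lemma semigroup_nonexpansive t x y : 0 <= t -> mdist (T t x) (T t y) <= mdist x y.
Proof.
move=> t0.
apply: (cvg_mdist_le (N := 0%N)
  (semigroup_cvg (x := x) t0) (semigroup_cvg (x := y) t0)).
by move=> n _; apply: iter_resolvent_nonexpansive => //; rewrite divr_ge0.
Qed.

Lemma semigroup_dist t x : 0 <= t -> mdist x (T t x) <= t * mdist x (F x).
Proof.
move=> t0; apply: (cvg_mdist_le (N := 1%N) (cvg_cst x) (semigroup_cvg (x := x) t0)).
move=> n n1; have tn0 : 0 <= t / n%:R by rewrite divr_ge0.
apply: le_trans (iter_resolvent_dist hX hF n x tn0) _.
by rewrite [n%:R * _]mulrC divfK// pnatr_eq0 -lt0n.
Qed.

Lemma semigroup_fix t y : 0 <= t -> F y = y -> T t y = y.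
Proof.
move=> t0 hy; apply/esym/mdist_positivity/eqP; rewrite eq_le mdist_ge0 andbT.
by apply: le_trans (semigroup_dist y t0) _; rewrite hy mdistxx mulr0.
Qed.

Lemma semigroup0 x : T 0 x = x.
Proof.
apply/esym/mdist_positivity/eqP; rewrite eq_le mdist_ge0 andbT.
by apply: le_trans (semigroup_dist x (lexx 0)) _; rewrite mul0r.
Qed.

(** On a mesh l = t/k, the scheme of m + k steps approximates T_(s+t) x, while its
    last m steps, started near T_t x, approximate T_s (T_t x). *)
Lemma semigroupD s t x : 0 <= s -> 0 <= t -> T (s + t) x = T s (T t x).
Proof.
move=> s0; rewrite le_eqVlt => /predU1P[<-|t0]; first by rewrite addr0 semigroup0.
apply: mdist_positivity; apply/eqP; rewrite eq_le mdist_ge0 andbT.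
apply/ler_addgt0Pr => e e0; rewrite add0r.
have e3 : 0 < e / 3 by rewrite divr_gt0.
have [d1 d10 h1] := semigroup_mesh_cvg (t := s + t) x ltac:(lra) e3.
have [d2 d20 h2] := semigroup_mesh_cvg x (ltW t0) e3.
have [d3 d30 h3] := semigroup_mesh_cvg (T t x) s0 e3.
pose d := Num.min d1 (Num.min d2 d3).
have d0 : 0 < d by rewrite !lt_min d10 d20 d30.
pose k := (Num.truncn (t / d)).+1.
have k0 : 0 < k%:R :> R by rewrite ltr0n.
pose l := t / k%:R; have l0 : 0 < l by rewrite divr_gt0.
have : l <= d.
  rewrite ler_pdivrMr// mulrC -ler_pdivrMr//; apply: ltW.
  by apply: gt_truncn => //; rewrite divr_ge0// ltW.
rewrite !le_min => /and3P[ld1 ld2 ld3].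
have klE : k%:R * l = t by rewrite /l; field; lra.
(* The time s need not be a multiple of the step l. *)
pose m := Num.truncn (s / l).
have ml : `|m%:R * l - s| <= l.
  have := truncn_itv (divr_ge0 s0 (ltW l0)); rewrite -/m.
  rewrite ler_pdivlMr// ltr_pdivrMr// -natr1 => /andP[? ?].
  by rewrite ler_norml; apply/andP; split; lra.
have := h2 l k l0 ld2; rewrite klE subrr normr0 => /(_ (ltW l0)) H2.
have H3 := h3 l m l0 ld3 ml.
have := h1 l (m + k)%N l0 ld1.
rewrite natrD mulrDl klE opprD addrACA subrr addr0 => /(_ ml).
rewrite iterD => H1.
have H4 := iter_resolvent_nonexpansive hX hF m (iter k (J l) x) (T t x) (ltW l0).
have := metric_triangle (T (s + t) x) (iter m (J l) (iter k (J l) x)) (T s (T t x)).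
have := metric_triangle (iter m (J l) (iter k (J l) x)) (iter m (J l) (T t x))
  (T s (T t x)).
rewrite (metric_sym (T (s + t) x) (iter _ _ _)); lra.
Qed.

(** The limit of [iter_resolvent_energy]. *)
Lemma semigroup_defect t x y : 0 <= t -> F y = y ->
  t * mdist (T t x) (F (T t x)) ^+ 2 <= mdist x y ^+ 2.
Proof.
rewrite le_eqVlt => /predU1P[<- _|t0 hy]; first by rewrite mul0r sqr_ge0.
have cvgT := semigroup_cvg (x := x) (ltW t0).
have cvgFT : F (iter n (J (t / n%:R)) x) @[n --> \oo] --> F (T t x).
  apply/cvg_mdistP => e e0; have [N hN] := (cvg_mdistP _ _).1 cvgT e e0.
  by exists N => n /hN; apply: le_lt_trans; exact: hF.
have B0 : 0 <= mdist x y ^+ 2 / t by rewrite divr_ge0 ?sqr_ge0// ltW.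
have : mdist (T t x) (F (T t x)) <= Num.sqrt (mdist x y ^+ 2 / t).
  apply: (cvg_mdist_le (N := 1%N) cvgT cvgFT) => n n1.
  rewrite -(ler_pXn2r (n := 2))// ?nnegrE ?mdist_ge0 ?sqrtr_ge0// sqr_sqrtr//.
  have tn0 : 0 <= t / n%:R by rewrite divr_ge0// ltW.
  have := iter_resolvent_energy hX hF n x tn0 hy.
  rewrite [n%:R * _]mulrC divfK ?pnatr_eq0 -?lt0n// ler_pdivlMr//.
  have := sqr_ge0 (mdist (iter n (J (t / n%:R)) x) y); lra.
rewrite -(ler_pXn2r (n := 2))// ?nnegrE ?mdist_ge0 ?sqrtr_ge0// sqr_sqrtr//.
by rewrite ler_pdivlMr// mulrC.
Qed.

End semigroups.

(** * The rate functions *)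

Section rates.
Variables (R : realType) (b : nat) (f : nat -> nat).
Hypothesis hf : forall m n : nat, (m <= n)%N -> (f m <= f n)%N.
Implicit Types (d e : R) (i j k : nat).

Lemma phi_ge d : 0 < d ->
  4 * b%:R / d * expR (4 * b%:R / d) <= (phi b d)%:R.
Proof.
move=> d0; rewrite /phi natr_absz ger0_norm.
  exact: ceil_ge.
rewrite ceil_ge0; apply: lt_le_trans (ltrN10 R) _.
by rewrite mulr_ge0 ?expR_ge0// divr_ge0 ?mulr_ge0// ltW.
Qed.

(** The energy estimate turns a time of at least (b/d)^2 into a defect of at most
    d. The bound follows from 1 + c <= e^c at c = 4b/d. *)
Lemma phi_ge_sqr d : 0 < d -> (b%:R / d) ^+ 2 <= (phi b d)%:R.
Proof.
move=> d0; apply: le_trans _ (phi_ge d0).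
have c0 : 0 <= b%:R / d by rewrite divr_ge0// ltW.
rewrite -(mulrA 4); set c := b%:R / d in c0 *.
have := expR_ge1Dx (4 * c) => h.
have c4 : 0 <= 4 * c by lra.
have := ler_wpM2l c4 h; have := sqr_ge0 c; lra.
Qed.

Lemma phi_nonincreasing d e : 0 < d -> d <= e -> (phi b e <= phi b d)%N.
Proof.
move=> d0 de; have e0 := lt_le_trans d0 de.
have h : 4 * b%:R / e <= 4 * b%:R / d.
  by rewrite ler_wpM2l// lef_pV2.
have nn (z : R) : 0 < z -> 0 <= 4 * b%:R / z.
  by move=> z0; rewrite divr_ge0 ?mulr_ge0// ltW.
have ce (z : R) : 0 < z -> 0 <= Num.ceil (4 * b%:R / z * expR (4 * b%:R / z)).
  move=> z0; rewrite ceil_ge0; apply: lt_le_trans (ltrN10 R) _.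
  by rewrite mulr_ge0 ?expR_ge0 ?nn.
rewrite /phi -lez_nat !gez0_abs ?ce//; apply: le_ceil.
by apply: ler_pM; rewrite ?nn ?expR_ge0 ?ler_expR.
Qed.

Lemma chi_den_ge k : 2 * (f (k + 1) + 1)%:R <= expR (2 * (f (k + 1) + 1)%:R) - 1 :> R.
Proof. by have := expR_ge1Dx (2 * (f (k + 1) + 1)%:R : R); lra. Qed.

Lemma chi_den_gt0 k : 0 < expR (2 * (f (k + 1) + 1)%:R) - 1 :> R.
Proof. by apply: lt_le_trans (chi_den_ge k); rewrite mulr_gt0// ltr0n addn1. Qed.

Lemma chi_gt0 d k : 0 < d -> 0 < chi f d k.
Proof. by move=> d0; rewrite /chi divr_gt0 ?chi_den_gt0// mulr_gt0. Qed.

Lemma chi_nonincreasing d i j : 0 < d -> (i <= j)%N -> chi f d j <= chi f d i.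
Proof.
move=> d0 ij; rewrite /chi ler_pM2l; last by rewrite mulr_gt0.
rewrite lef_pV2 ?posrE ?chi_den_gt0// lerB// ler_expR ler_pM2l//.
by rewrite ler_nat leq_add2r; apply: hf; rewrite leq_add2r.
Qed.

(** If F moves a point by at most chi, then T_s moves it by at most s times that;
    for the given s this is at most d, since e^(2a) - 1 >= 2a. *)
Lemma mul_chi_le d k s : 0 < d -> 0 <= s -> s <= (f (k + 1) + 1)%:R ->
  s * chi f d k <= d.
Proof.
move=> d0 s0 hs; have h := chi_den_ge k; have g0 := chi_den_gt0 k.
rewrite /chi mulrA ler_pdivrMr// [leRHS]mulrC.
have := ler_wpM2r (ltW d0) (le_trans (_ : 2 * s <= _) h); rewrite ler_pM2l// hs.
by move=> /(_ isT); lra.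
Qed.

Variable e : R.
Hypothesis e0 : 0 < e.

Notation K i := (phi b (eps_hat b f e i.+1)).

Lemma eps_hat1 : eps_hat b f e 1 = chi f (e / 6) 0.
Proof. by []. Qed.

Lemma eps_hatSS i : eps_hat b f e i.+2 = chi f (e / 6) (K i).
Proof. by []. Qed.

Lemma eps_hat_gt0 i : 0 < eps_hat b f e i.+1.
Proof. by case: i => [|i]; apply: chi_gt0; rewrite divr_gt0. Qed.

(** A larger time makes chi smaller, since f is nondecreasing, and a smaller
    tolerance makes phi larger. *)
Lemma phi_eps_hat_nondecreasing i j : (i <= j)%N -> (K i <= K j)%N.
Proof.
have e6 : 0 < e / 6 by rewrite divr_gt0.
apply: (homo_leq (f := fun i => K i) leqnn (fun _ _ _ => @leq_trans _ _ _)) => k.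
apply: phi_nonincreasing; first exact: (eps_hat_gt0 k.+1).
elim: k => [|k IH]; rewrite eps_hatSS;
  first by rewrite eps_hat1; exact: chi_nonincreasing.
rewrite eps_hatSS; apply: chi_nonincreasing => //; apply: phi_nonincreasing => //.
exact: (eps_hat_gt0 k.+1).
Qed.

End rates.

(** * Asymptotic regularity and metastability *)

Lemma semigroup_defect_rate (R : realType) (X : completeMetricType R)
    (F : X -> X) (x y : X) (b : nat) (d : R) :
  hadamard X -> nonexpansive F -> F y = y -> mdist x y <= b%:R -> 0 < d ->
  let z := semigroup F (phi b d)%:R x in mdist z (F z) <= d.
Proof.
move=> hX hF hy hb d0 /=.
(* For x = y the number b may be 0, and the energy estimate at time 0 is void. *)
have [xy|xy] := eqVneq x y; first by rewrite xy semigroup_fix// hy mdistxx ltW.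
have b0 : 0 < b%:R :> R by apply: lt_le_trans hb; rewrite mdist_gt0.
have K0 : 0 <= (phi b d)%:R :> R by [].
have h := semigroup_defect hX hF x K0 hy; have hK := phi_ge_sqr b d0.
rewrite -(ler_pXn2r (n := 2))// ?nnegrE ?mdist_ge0 ?(ltW d0)//.
have b2 : 0 < b%:R ^+ 2 :> R by rewrite exprn_gt0.
have hxy : mdist x y ^+ 2 <= b%:R ^+ 2.
  by rewrite ler_pXn2r ?nnegrE ?mdist_ge0.
have := le_trans (ler_wpM2r (sqr_ge0 _) hK) (le_trans h hxy).
by rewrite exprMn exprVn -mulrA ger_pMr// ler_pdivrMl ?exprn_gt0// mulr1.
Qed.

Unset Implicit Arguments.

Theorem theorem4p40 (R : realType) (X : completeMetricType R) (F : X -> X)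
    (x y : X) (b : nat) (gamma : R -> nat)
    (hX : hadamard X) (hF : nonexpansive F) (hy : F y = y)
    (hb : mdist x y <= b%:R)
    (hgamma : total_boundedness_modulus (cball y b%:R) gamma)
    (eps : R) (heps : 0 < eps)
    (f : nat -> nat) (hf : forall m n : nat, (m <= n)%N -> (f m <= f n)%N) :
  exists2 n : nat, (n <= Delta b f gamma eps)%N &
    forall s t : R, s \in `[n%:R, (n + f n)%:R] -> t \in `[n%:R, (n + f n)%:R] ->
      mdist (semigroup F t x) (semigroup F s x) <= eps.
Proof.
have e6 : 0 < eps / 6 by rewrite divr_gt0.
pose K i := phi b (eps_hat b f eps i.+1); pose z i := semigroup F (K i)%:R x.
have zF i : mdist (z i) (F (z i)) <= eps_hat b f eps i.+1.
  exact: (semigroup_defect_rate hX hF hy hb (eps_hat_gt0 b f heps i)).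
have zb i : cball y b%:R (z i).
  rewrite /cball /= metric_sym -{1}(semigroup_fix hX hF (t := (K i)%:R) _ hy)//.
  exact: le_trans (semigroup_nonexpansive hX hF x y _) hb.
have [i [[|j] [ij jg zij]]] := hgamma _ z e6 zb; first by [].
have Kij : (K i <= K j)%N by exact: (phi_eps_hat_nondecreasing b hf heps).
exists (K i).
  (* The indices 0, ..., gamma (eps / 6) match eps_hat 1, ..., eps_hat P for
     P = gamma (eps / 6) + 1. *)
  rewrite /Delta addn1.
  exact: (phi_eps_hat_nondecreasing b hf heps (leq_trans (ltnW ij) jg)).
have nears s : s \in `[(K i)%:R, (K i + f (K i))%:R] ->
    mdist (semigroup F s x) (z j.+1) <= eps / 3.
  rewrite in_itv /= natrD => /andP[s1 s2].
  have s0 : 0 <= s - (K i)%:R by lra.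
  rewrite -(subrK (K i)%:R s) semigroupD// -/(z i).
  have h1 := semigroup_nonexpansive hX hF (z i) (z j.+1) s0.
  have h2 := semigroup_dist hX hF (z j.+1) s0.
  (* Here j.+1 is the index given by total boundedness, so i <= j and the
     time s - K i is at most f (K i) <= f (K j + 1) + 1. *)
  have h3 : (s - (K i)%:R) * mdist (z j.+1) (F (z j.+1)) <= eps / 6.
    apply: le_trans (ler_wpM2l s0 (zF j.+1)) _; rewrite eps_hatSS.
    apply: mul_chi_le => //; apply: (@le_trans _ _ (f (K i))%:R); first lra.
    rewrite ler_nat (leq_trans (hf _ (K j + 1)%N _)) ?leq_addr//.
    by rewrite (leq_trans Kij) ?leq_addr.
  have h4 : mdist (semigroup F (s - (K i)%:R) (z j.+1)) (z j.+1) <= eps / 6.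
    by rewrite metric_sym; exact: le_trans h2 h3.
  apply: le_trans (metric_triangle _ _ _) _.
  have -> : eps / 3 = eps / 6 + eps / 6 by field.
  exact: lerD (le_trans h1 zij) h4.
move=> s t /nears hs /nears ht; rewrite metric_sym in hs.
apply: le_trans (metric_triangle _ (z j.+1) _) _.
apply: le_trans (lerD ht hs) _; clear -heps; lra.
Qed.
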